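(* Suppose that $\eta^2(\nu)$ is quadratic in $\nu$, that $m_1(\nu)$ and $\eta(\nu)m_2(\nu)$ are linear in $\nu$, and that $m_2^2(\nu)$ is a constant. Suppose $h(t,\nu)$ is conjectured in the exponential-polynomial form such that $$\omega(t,x,\nu)=\frac{x^{1-\gamma}}{1-\gamma}h(t,\nu)^{1-\gamma}=\frac{x^{1-\gamma}}{1-\gamma}\exp\left\{(1-\gamma)\left(A_0(T-t)+\sum_{k=1}^n\frac1kA_k(T-t)\nu^k\right)\right\},$$ where $A_k(\tau)$, $k=0,\dots,n$, are functions of $\tau$ with $A_0(0)=\ln\varepsilon$ and $A_k(0)=0$ for $k=1,\dots,n$. Then the PDE $$h_t+\left[r-\beta+\frac{1}{2\gamma}\eta^2(\nu)+\beta(\ln\beta-\ln h)\right]h+\left[m_1(\nu)+\frac{\eta(\nu)}{\gamma}\rho m_2(\nu)(1-\gamma)\right]h_\nu+\frac12m_2^2(\nu)\left[\frac{\rho^2(1-\gamma)^2}{\gamma}-\gamma\right]\frac{h_\nu^2}{h}+\frac12m_2^2(\nu)h_{\nu\nu}=0$$ has no analytical solutions (of this form) when the order $n$ of the polynomial is higher than $2$.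
   Context: Parameters: $T>0$, $r>0$, $\beta>0$, $\varepsilon>0$, $\gamma>0$ with $\gamma\neq1$, $\rho\in[-1,1]$; $\eta,m_1,m_2$ are real functions of the state variable $\nu$, where $d\nu_t=m_1(\nu_t)dt+m_2(\nu_t)dW^\nu_t$, $m_2$ is the volatility of the state variable and $\eta(\nu_t)$ is the market price of risk. ''Linear in $\nu$'' means a first-order polynomial $a+b\nu$. The PDE is to hold for $t\in[0,T]$ and identically in $\nu$ on the state space. It arises from the finite-horizon consumption–investment problem with recursive utility, unit elasticity of intertemporal substitution and bequest utility $U(x)=\varepsilon^{1-\gamma}\frac{x^{1-\gamma}}{1-\gamma}$, via the ansatz $\omega(t,x,\nu)=\frac{x^{1-\gamma}}{1-\gamma}h(t,\nu)^{1-\gamma}$ for the HJB equation. The polynomial $A_0+\sum_{k=1}^n\frac1kA_k\nu^k$ has order $n$ when the function $A_n$ is not identically zero. An ''analytical solution'' means a function $h$ of the stated exponential-polynomial form satisfying the PDE. *)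

(* Defs.v *)
From Stdlib Require Import Reals.
From Coquelicot Require Import Coquelicot.

Local Open Scope R_scope.

(** The state variable takes its values in an interval that is not reduced to
    a point; it may be open or closed, bounded or not (in particular all of R). *)
Definition state_space (D : R -> Prop) : Prop :=
  (forall x y z : R, D x -> D y -> x <= z <= y -> D z) /\
  (exists x y : R, D x /\ D y /\ x < y).

Definition constant_on (D : R -> Prop) (f : R -> R) : Prop :=
  exists c : R, forall nu, D nu -> f nu = c.

(** The coefficients [b] below, and [b], [c] in [quadratic_on], may vanish. *)
Definition linear_on (D : R -> Prop) (f : R -> R) : Prop :=
  exists a b : R, forall nu, D nu -> f nu = a + b * nu.

Definition quadratic_on (D : R -> Prop) (f : R -> R) : Prop :=
  exists a b c : R, forall nu, D nu -> f nu = a + b * nu + c * nu ^ 2.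

(** [D_in f g S x] says that [g x] is the derivative of [f] at [x] relative to
    the set [S]: derivatives are two-sided inside the time interval [0, T] and
    the state space, and one-sided at endpoints that belong to them. *)
Definition solves_PDE (T r beta gamma rho : R) (D : R -> Prop)
    (eta m1 m2 : R -> R) (h : R -> R -> R) : Prop :=
  exists h_t h_nu h_nunu : R -> R -> R,
  forall t nu : R, 0 <= t <= T -> D nu ->
    D_in (fun s => h s nu) (fun s => h_t s nu) (fun s => 0 <= s <= T) t /\
    D_in (h t) (h_nu t) D nu /\
    D_in (h_nu t) (h_nunu t) D nu /\
    h_t t nu
    + (r - beta + 1 / (2 * gamma) * eta nu ^ 2
       + beta * (ln beta - ln (h t nu))) * h t nu
    + (m1 nu + eta nu / gamma * rho * m2 nu * (1 - gamma)) * h_nu t nu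
    + 1 / 2 * m2 nu ^ 2 * (rho ^ 2 * (1 - gamma) ^ 2 / gamma - gamma)
      * (h_nu t nu ^ 2 / h t nu)
    + 1 / 2 * m2 nu ^ 2 * h_nunu t nu = 0.

Definition exponent (n : nat) (A : nat -> R -> R) (tau nu : R) : R :=
  A 0%nat tau + sum_n_m (fun k => 1 / INR k * A k tau * nu ^ k) 1 n.

(** The ansatz for the value function, for wealth [x > 0]. *)
Definition omega (gamma : R) (h : R -> R -> R) (t x nu : R) : R :=
  Rpower x (1 - gamma) / (1 - gamma) * Rpower (h t nu) (1 - gamma).

(** [h] is positive, as [ln h] and the real power [h ^ (1 - gamma)] require:
    the total functions [ln] and [Rpower] carry no meaning elsewhere. *)
Definition exp_poly_form (T eps gamma : R) (D : R -> Prop) (n : nat)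
    (A : nat -> R -> R) (h : R -> R -> R) : Prop :=
  A 0%nat 0 = ln eps /\
  (forall k : nat, (1 <= k <= n)%nat -> A k 0 = 0) /\
  (forall t nu : R, 0 <= t <= T -> D nu ->
     0 < h t nu /\
     forall x : R, 0 < x ->
       omega gamma h t x nu =
       Rpower x (1 - gamma) / (1 - gamma)
       * exp ((1 - gamma) * exponent n A (T - t) nu)).

Definition has_order (T : R) (n : nat) (A : nat -> R -> R) : Prop :=
  exists tau : R, 0 <= tau <= T /\ A n tau <> 0.

Definition analytical_solution (T r beta eps gamma rho : R) (D : R -> Prop)
    (eta m1 m2 : R -> R) (n : nat) (h : R -> R -> R) : Prop :=
  (exists A : nat -> R -> R,
     exp_poly_form T eps gamma D n A h /\ has_order T n A) /\
  solves_PDE T r beta gamma rho D eta m1 m2 h.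

(* Main.v *)
Require Import Defs.
From Stdlib Require Import Reals Lra Lia.
From Coquelicot Require Import Coquelicot.

Local Open Scope R_scope.

(** Where [h = exp P], dividing the PDE by [h] turns it into
    [P_t = beta P - L P_nu - kappa P_nu^2 - c/2 P_nunu - q], where
    [c = m2^2] is constant, [L] is linear and [q] quadratic in [nu], and
    [kappa = c/2 (rho^2 (1-gamma)^2 / gamma + 1 - gamma)].  The second factor of
    [kappa] never vanishes, because [rho^2 <= 1].  Let [P] have degree at most
    [n >= 3] in [nu], with leading coefficient [a(t)].

    If [c <> 0], the term [P_nu^2] contributes [kappa (n a)^2 nu^(2n-2)], and
    every other term, [P_t] included, has degree at most [n < 2n-2]; hence
    [a = 0] at all times.  If [c = 0], the coefficient of [nu^n] gives the
    linear equation [a' = k a], and the condition [a(T) = 0] forces [a = 0].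
    Either way the order of the polynomial is not [n].

    Reading off coefficients of [P_t] needs care: the PDE provides derivatives
    in time for each fixed [nu] in the state space, not for the coefficients
    of [P].  Lemma [D_in_top_coeff] closes this gap by finite differences in
    [nu], which also avoids any discussion of when two polynomials that agree on
    an interval have equal coefficients. *)

(** * Polynomials with a prescribed coefficient in top degree *)

(** [f] is a polynomial of degree at most [d] whose coefficient of degree [d]
    is [a]; since [a = 0] is allowed, a bound on the degree can be relaxed. *)
Fixpoint has_top (d : nat) (a : R) (f : R -> R) : Prop :=
  match d with
  | O => forall x, f x = a
  | S d' => exists (b : R) (g : R -> R),
      has_top d' b g /\ forall x, f x = a * x ^ d + g x
  end.

Lemma has_top_ext d a b f g :
  has_top d a f -> a = b -> (forall x, f x = g x) -> has_top d b g.
Proof.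
  intros H -> E. destruct d as [|d]; simpl in *.
  - intros x. rewrite <- E. apply H.
  - destruct H as (c & k & Hk & H). exists c, k. split; [exact Hk|].
    intros x. rewrite <- E. apply H.
Qed.

Lemma has_top_plus d a b f g :
  has_top d a f -> has_top d b g -> has_top d (a + b) (fun x => f x + g x).
Proof.
  revert a b f g. induction d as [|d IH]; intros a b f g; simpl.
  - intros Hf Hg x. now rewrite Hf, Hg.
  - intros (a' & f' & Hf' & Hf) (b' & g' & Hg' & Hg).
    exists (a' + b'), (fun x => f' x + g' x). split; [now apply IH|].
    intros x. rewrite Hf, Hg. ring.
Qed.

Lemma has_top_scal d a k f :
  has_top d a f -> has_top d (k * a) (fun x => k * f x).
Proof.
  revert a f. induction d as [|d IH]; intros a f; simpl.
  - intros Hf x. now rewrite Hf.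
  - intros (a' & f' & Hf' & Hf).
    exists (k * a'), (fun x => k * f' x). split; [now apply IH|].
    intros x. rewrite Hf. ring.
Qed.

Lemma has_top_raise d e a f : (d < e)%nat -> has_top d a f -> has_top e 0 f.
Proof.
  revert a. induction e as [|e IH]; intros a Hde Hf; [lia|].
  assert (H : exists b, has_top e b f).
  { destruct (Nat.eq_dec d e) as [->|Hne]; [now exists a|].
    exists 0. apply (IH a); [lia|exact Hf]. }
  destruct H as [b H]. exists b, f. split; [exact H|]. intros x. ring.
Qed.

Lemma has_top_const c : has_top 0 c (fun _ => c).
Proof. now intros x. Qed.

Lemma has_top_linear a b : has_top 1 b (fun x => a + b * x).
Proof.
  exists a, (fun _ => a). split; [apply has_top_const|]. intros x. ring.
Qed.

Lemma has_top_quadratic a b c : has_top 2 c (fun x => a + b * x + c * x ^ 2).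
Proof.
  exists b, (fun x => a + b * x). split; [apply has_top_linear|]. intros x. ring.
Qed.

Lemma has_top_pow_mult k e b g :
  has_top e b g -> has_top (k + e) b (fun x => x ^ k * g x).
Proof.
  intros Hg. induction k as [|k IH].
  - eapply has_top_ext; [exact Hg|reflexivity|]. intros x. simpl. ring.
  - assert (Hx : forall d c u, has_top d c u -> has_top (S d) c (fun x => x * u x)).
    { clear. induction d as [|d IH]; intros c u.
      - intros Hu. exists 0, (fun _ => 0). split; [apply has_top_const|].
        intros x. rewrite (Hu x). simpl. ring.
      - intros (c' & u' & Hu' & Hu). exists c', (fun x => x * u' x).
        split; [now apply IH|]. intros x. rewrite Hu. simpl. ring. }
    eapply has_top_ext; [apply Hx, IH|reflexivity|]. intros x. simpl. ring.
Qed.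

Lemma has_top_pow k : has_top k 1 (fun x => x ^ k).
Proof.
  rewrite <- (Nat.add_0_r k) at 1.
  eapply has_top_ext;
    [exact (has_top_pow_mult k _ _ _ (has_top_const 1))|reflexivity|].
  intros x. apply Rmult_1_r.
Qed.

Lemma has_top_mult d e a b f g :
  has_top d a f -> has_top e b g ->
  has_top (d + e) (a * b) (fun x => f x * g x).
Proof.
  intros Hf Hg. revert a f Hf. induction d as [|d IH]; intros a f Hf.
  - eapply has_top_ext; [exact (has_top_scal e b a g Hg)|reflexivity|].
    intros x. simpl in Hf. now rewrite Hf.
  - destruct Hf as (a' & f' & Hf' & Hf).
    eapply has_top_ext.
    + apply has_top_plus.
      * eapply (has_top_scal _ _ a), (has_top_pow_mult (S d)), Hg.
      * eapply (has_top_raise (d + e)); [lia|]. exact (IH a' f' Hf').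
    + ring.
    + intros x. simpl. rewrite Hf. simpl. ring.
Qed.

Lemma has_top_derive d a f :
  has_top (S d) a f ->
  exists f', has_top d (INR (S d) * a) f' /\
    forall x, is_derive f x (f' x).
Proof.
  revert a f. induction d as [|d IH]; intros a f (b & g & Hg & Hf).
  - exists (fun _ => a). split; [intros x; simpl; ring|].
    intros x. apply is_derive_ext with (fun x => a * x + b).
    + intros y. simpl in Hg. rewrite Hf, Hg. simpl. ring.
    + auto_derive; [easy|ring].
  - destruct (IH b g Hg) as (g' & Hg' & Dg).
    exists (fun x => a * (INR (S (S d)) * x ^ S d) + g' x). split.
    + exists (INR (S d) * b), g'. split; [exact Hg'|]. intros x. ring.
    + intros x. apply is_derive_ext with (fun x => a * x ^ S (S d) + g x).
      { intros y. now rewrite Hf. }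
      refine (is_derive_plus _ _ _ _ _ _ (Dg x)).
      auto_derive; [easy|]. rewrite Rmult_1_l. reflexivity.
Qed.

(** A finite difference lowers the degree by one, just like a derivative, and
    multiplies the top coefficient by a factor that is nonzero if [dl] is. *)
Lemma has_top_difference d a dl f :
  has_top (S d) a f ->
  has_top d (INR (S d) * dl * a) (fun x => f (x + dl) - f x).
Proof.
  assert (Hpow : forall d,
    has_top d (INR (S d) * dl) (fun x => (x + dl) ^ S d - x ^ S d)).
  { clear. induction d as [|d IH].
    - intros x. simpl. ring.
    - eapply has_top_ext.
      + apply has_top_plus.
        * apply (has_top_mult 1 d); [apply (has_top_linear dl 1)|exact IH].
        * exact (has_top_scal _ _ dl _ (has_top_pow (S d))).
      + rewrite (S_INR (S d)). ring.
      + intros x. simpl. ring. }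
  revert a f. induction d as [|d IH]; intros a f (b & g & Hg & Hf).
  - intros x. simpl in Hg. rewrite !Hf, !Hg. simpl. ring.
  - eapply has_top_ext.
    + apply has_top_plus.
      * eapply (has_top_scal _ _ a), (Hpow (S d)).
      * eapply (has_top_raise d); [lia|]. apply (IH b g Hg).
    + ring.
    + intros x. cbv beta. rewrite !Hf. ring.
Qed.

Lemma has_top_exponent n A tau :
  has_top (S n) (1 / INR (S n) * A (S n) tau) (exponent (S n) A tau).
Proof.
  assert (H : exists b, has_top n b (exponent n A tau)).
  { induction n as [|n [b IH]].
    - exists (A 0%nat tau). intros x. unfold exponent.
      rewrite sum_n_m_zero; [|lia]. apply Rplus_0_r.
    - exists (1 / INR (S n) * A (S n) tau), b, (exponent n A tau).
      split; [exact IH|]. intros x. unfold exponent.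
      rewrite sum_n_Sm; [|lia]. unfold plus. cbn -[INR pow]. ring. }
  destruct H as [b H]. exists b, (exponent n A tau).
  split; [exact H|]. intros x. unfold exponent.
  rewrite sum_n_Sm; [|lia]. unfold plus. cbn -[INR pow]. ring.
Qed.

(** * Derivatives relative to an interval *)

Lemma D_in_unique D f d1 d2 x :
  state_space D -> D x -> D_in f d1 D x -> D_in f d2 D x -> d1 x = d2 x.
Proof.
  intros [Hconv (u & v & Du & Dv & Huv)] Dx H1 H2.
  refine (single_limit _ _ _ _ _ _ H1 H2).
  intros alp Halp. unfold D_x, Rdist.
  destruct (Rlt_or_le x v) as [Hxv|Hvx].
  - exists (Rmin v (x + alp / 2)).
    assert (x < Rmin v (x + alp / 2)) by (apply Rmin_glb_lt; lra).
    pose proof (Rmin_l v (x + alp / 2)). pose proof (Rmin_r v (x + alp / 2)).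
    repeat split.
    + apply (Hconv x v); [exact Dx|exact Dv|lra].
    + lra.
    + rewrite Rabs_pos_eq; lra.
  - exists (Rmax u (x - alp / 2)).
    assert (Rmax u (x - alp / 2) < x) by (apply Rmax_lub_lt; lra).
    pose proof (Rmax_l u (x - alp / 2)). pose proof (Rmax_r u (x - alp / 2)).
    repeat split.
    + apply (Hconv u x); [exact Du|exact Dx|lra].
    + lra.
    + rewrite Rabs_left; lra.
Qed.

Lemma D_in_eq_on (D : R -> Prop) f g d x :
  (forall y, D y -> f y = g y) -> D x -> D_in f d D x -> D_in g d D x.
Proof.
  intros E Dx H eps Heps. destruct (H eps Heps) as (alp & Ha & Hb).
  exists alp. split; [exact Ha|]. intros y [[Dy Hne] Hd].
  rewrite <- (E y Dy), <- (E x Dx). apply Hb. split; [split|]; assumption.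
Qed.

Lemma is_derive_D_in (D : R -> Prop) f x l :
  is_derive f x l -> D_in f (fun _ => l) D x.
Proof.
  intros H. apply (D_in_imp _ _ no_cond); [now intros|].
  apply derivable_pt_lim_D_in, is_derive_Reals, H.
Qed.

Lemma state_space_time T : 0 < T -> state_space (fun s => 0 <= s <= T).
Proof.
  intros HT. split; [intros; lra|]. exists 0, T. lra.
Qed.

(** Freezing the function outside [[0, T]] at its values at the endpoints turns
    one-sided zero derivatives there into two-sided ones. *)
Lemma D_in_zero_const T f :
  0 < T ->
  (forall t, 0 <= t <= T -> D_in f (fun _ => 0) (fun s => 0 <= s <= T) t) ->
  forall t, 0 <= t <= T -> f t = f T.
Proof.
  intros HT Hf t Ht.
  set (clamp := fun s => Rmax 0 (Rmin T s)).
  assert (Hin : forall s, 0 <= clamp s <= T).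
  { intros s. unfold clamp, Rmax, Rmin.
    destruct (Rle_dec T s), (Rle_dec 0 _); lra. }
  assert (Hid : forall s, 0 <= s <= T -> clamp s = s).
  { intros s Hs. unfold clamp, Rmax, Rmin.
    destruct (Rle_dec T s), (Rle_dec 0 _); lra. }
  assert (Hlip : forall s k, 0 <= s <= T -> Rabs (clamp (s + k) - s) <= Rabs k).
  { intros s k Hs. unfold clamp, Rmax, Rmin.
    destruct (Rle_dec T (s + k)), (Rle_dec 0 _);
      unfold Rabs; repeat destruct Rcase_abs; lra. }
  destruct (Req_dec t T) as [->|Hne]; [reflexivity|].
  rewrite <- (Hid t Ht), <- (Hid T) by lra.
  apply (eq_is_derive (fun s => f (clamp s))); [|lra].
  intros s Hs. apply is_derive_Reals. intros eps Heps.
  assert (Hs' : 0 <= s <= T) by lra.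
  destruct (Hf s Hs' eps Heps) as (alp & Ha & Hb).
  exists (mkposreal alp Ha). intros k Hk0 Hk. simpl in Hk.
  specialize (Hlip s k Hs'). rewrite (Hid s Hs').
  change (zero : R) with 0. rewrite Rminus_0_r.
  assert (Hkp := Rabs_pos_lt k Hk0).
  destruct (Req_dec s (clamp (s + k))) as [E|E].
  - rewrite <- E. replace ((f s - f s) / k) with 0 by (field; exact Hk0).
    now rewrite Rabs_R0.
  - specialize (Hb (clamp (s + k))). cbn in Hb. unfold Rdist in Hb.
    rewrite Rminus_0_r in Hb.
    assert (Hq : Rabs ((f (clamp (s + k)) - f s) / (clamp (s + k) - s)) < eps).
    { apply Hb. split; [split; [apply Hin|exact E]|lra]. }
    (* the clamped quotient is the relative one times a factor at most 1 *)
    replace ((f (clamp (s + k)) - f s) / k)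
      with ((f (clamp (s + k)) - f s) / (clamp (s + k) - s)
            * ((clamp (s + k) - s) / k)) by (field; split; [exact Hk0|lra]).
    rewrite Rabs_mult.
    apply Rle_lt_trans with (2 := Hq).
    rewrite <- (Rmult_1_r (Rabs (_ / (clamp (s + k) - s)))) at 2.
    apply Rmult_le_compat_l; [apply Rabs_pos|].
    unfold Rdiv. rewrite Rabs_mult, Rabs_inv.
    apply (Rmult_le_reg_r (Rabs k)); [exact Hkp|].
    rewrite Rmult_assoc, Rinv_l; lra.
Qed.

(** The function [a(t) exp(-k t)] is constant. *)
Lemma linear_ode_zero T k a :
  0 < T ->
  (forall t, 0 <= t <= T ->
     D_in a (fun s => k * a s) (fun s => 0 <= s <= T) t) ->
  a T = 0 -> forall t, 0 <= t <= T -> a t = 0.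
Proof.
  intros HT Ha HaT t Ht.
  assert (H : a t * exp (- k * t) = a T * exp (- k * T)).
  { apply (D_in_zero_const T (fun s => a s * exp (- k * s)) HT); [|exact Ht].
    intros s Hs.
    assert (He : D_in (fun s => exp (- k * s)) (fun _ => - k * exp (- k * s))
                   (fun s => 0 <= s <= T) s).
    { apply is_derive_D_in. auto_derive; [easy|ring]. }
    generalize (Dmult _ _ _ _ _ _ (Ha s Hs) He). unfold D_in.
    replace (k * a s * exp (- k * s) + a s * (- k * exp (- k * s))) with 0 by ring.
    easy. }
  rewrite HaT, Rmult_0_l in H.
  destruct (Rmult_integral _ _ H) as [E|E]; [exact E|].
  pose proof (exp_pos (- k * t)). lra.
Qed.

(** Finite differences in [nu] commute with the derivative in time, so [d] of
    them reduce the claim to constants; a step of half the length of [[x, y]]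
    leaves an interval for the next difference. *)
Lemma D_in_top_coeff I t d (a : R -> R) b (P : R -> R -> R) Q x y :
  x < y -> I t ->
  (forall s, I s -> has_top d (a s) (P s)) -> has_top d b Q ->
  (forall nu, x <= nu <= y -> D_in (fun s => P s nu) (fun _ => Q nu) I t) ->
  D_in a (fun _ => b) I t.
Proof.
  intros Hxy It. revert a b P Q x y Hxy.
  induction d as [|d IH]; intros a b P Q x y Hxy HP HQ HD.
  - simpl in HP, HQ. rewrite <- (HQ x).
    apply (D_in_eq_on I (fun s => P s x)); [|exact It|apply HD; lra].
    intros s Is. now apply HP.
  - set (dl := (y - x) / 2).
    assert (Hdl : 0 < dl) by (unfold dl; lra).
    assert (Hc : 0 < INR (S d) * dl).
    { apply Rmult_lt_0_compat; [apply lt_0_INR; lia|exact Hdl]. }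
    assert (H : D_in (fun s => INR (S d) * dl * a s)
                  (fun _ => INR (S d) * dl * b) I t).
    { apply (IH _ _ (fun s nu => P s (nu + dl) - P s nu)
               (fun nu => Q (nu + dl) - Q nu) x (x + dl)); [lra| | |].
      - intros s Is. now apply has_top_difference, HP.
      - now apply has_top_difference.
      - intros nu Hnu.
        apply (Dminus I (fun _ => Q (nu + dl)) (fun _ => Q nu)
                 (fun s => P s (nu + dl)) (fun s => P s nu));
          apply HD; unfold dl in *; lra. }
    apply (Dmult_const _ _ _ _ (/ (INR (S d) * dl))) in H.
    replace b with (/ (INR (S d) * dl) * (INR (S d) * dl * b))
      by (rewrite <- Rmult_assoc, Rinv_l; [ring|lra]).
    apply (D_in_eq_on I (fun s => / (INR (S d) * dl) * (INR (S d) * dl * a s)));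
      [|exact It|exact H].
    intros s _. rewrite <- Rmult_assoc, Rinv_l; [ring|lra].
Qed.

(** * The PDE for the logarithm of a solution *)

Lemma ansatz_exp T eps gamma D n A h :
  gamma <> 1 -> exp_poly_form T eps gamma D n A h ->
  forall t nu, 0 <= t <= T -> D nu ->
    h t nu = exp (exponent n A (T - t) nu).
Proof.
  intros Hg (_ & _ & H) t nu Ht Dnu.
  destruct (H t nu Ht Dnu) as [Hpos Hom].
  specialize (Hom 1 Rlt_0_1). unfold omega, Rpower in Hom.
  rewrite ln_1, Rmult_0_r, exp_0 in Hom.
  apply Rmult_eq_reg_l, exp_inv, Rmult_eq_reg_l in Hom.
  - rewrite <- Hom. now rewrite exp_ln.
  - lra.
  - apply Rmult_integral_contrapositive_currified; [lra|].
    apply Rinv_neq_0_compat. lra.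
Qed.

(** The PDE divided by [h], with [h_nu / h = P_nu] and
    [h_nunu / h = P_nunu + P_nu^2]: this second identity adds [1] to the factor
    [rho^2 (1-gamma)^2 / gamma - gamma] of the nonlinear term. *)
Lemma log_PDE T r beta gamma rho D eta m1 m2 h P t P1 P2 :
  state_space D -> 0 < T ->
  solves_PDE T r beta gamma rho D eta m1 m2 h ->
  (forall s nu, 0 <= s <= T -> D nu -> h s nu = exp (P s nu)) ->
  0 <= t <= T ->
  (forall nu, is_derive (P t) nu (P1 nu)) ->
  (forall nu, is_derive P1 nu (P2 nu)) ->
  forall nu, D nu ->
  D_in (fun s => P s nu)
    (fun _ => beta * P t nu
       - (m1 nu + eta nu / gamma * rho * m2 nu * (1 - gamma)) * P1 nu
       - m2 nu ^ 2 / 2 * (rho ^ 2 * (1 - gamma) ^ 2 / gamma + 1 - gamma)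
         * (P1 nu * P1 nu)
       - m2 nu ^ 2 / 2 * P2 nu
       - (r - beta + 1 / (2 * gamma) * eta nu ^ 2 + beta * ln beta))
    (fun s => 0 <= s <= T) t.
Proof.
  intros HD HT (ht & hx & hxx & Hsol) Hexp Ht HP1 HP2 nu Dnu.
  assert (Hhx : forall z, D z -> hx t z = P1 z * exp (P t z)).
  { intros z Dz. destruct (Hsol t z Ht Dz) as (_ & Hd & _).
    refine (D_in_unique D (h t) (hx t) (fun _ => P1 z * exp (P t z)) z HD Dz Hd _).
    apply (D_in_eq_on D (fun z => exp (P t z))); [|exact Dz|].
    - intros w Dw. now rewrite Hexp.
    - apply is_derive_D_in.
      exact (is_derive_comp exp (P t) _ _ _ (is_derive_exp _) (HP1 _)). }
  assert (Hhxx : hxx t nu = (P2 nu + P1 nu * P1 nu) * exp (P t nu)).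
  { destruct (Hsol t nu Ht Dnu) as (_ & _ & Hd & _).
    refine (D_in_unique D (hx t) (hxx t)
              (fun _ => (P2 nu + P1 nu * P1 nu) * exp (P t nu)) nu HD Dnu Hd _).
    apply (D_in_eq_on D (fun z => P1 z * exp (P t z))); [|exact Dnu|].
    - intros w Dw. now rewrite Hhx.
    - apply is_derive_D_in.
      replace ((P2 nu + P1 nu * P1 nu) * exp (P t nu))
        with (P2 nu * exp (P t nu) + P1 nu * (P1 nu * exp (P t nu))) by ring.
      apply (is_derive_mult P1 (fun z => exp (P t z))).
      + apply HP2.
      + exact (is_derive_comp exp (P t) _ _ _ (is_derive_exp _) (HP1 _)).
      + intros p q. apply Rmult_comm. }
  destruct (Hsol t nu Ht Dnu) as (Hd & _ & _ & Heq).
  rewrite Hhxx, (Hhx nu Dnu), (Hexp t nu Ht Dnu), ln_exp in Heq.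
  assert (HE := exp_pos (P t nu)). set (E := exp (P t nu)) in *.
  assert (Hln : D_in (fun s => P s nu) (fun _ => ht t nu * / E)
                  (fun s => 0 <= s <= T) t).
  { apply (D_in_eq_on _ (fun s => ln (h s nu))); [|exact Ht|].
    { intros s Hs. now rewrite (Hexp s nu Hs Dnu), ln_exp. }
    assert (Hl : D_in ln (fun _ => / E) (fun x => 0 < x) (h t nu)).
    { unfold E. rewrite <- (Hexp t nu Ht Dnu). apply Dln.
      rewrite (Hexp t nu Ht Dnu). exact HE. }
    pose proof (Dcomp _ _ _ _ _ _ _ Hd Hl) as Hc.
    apply (D_in_imp _ _ _ (fun s => 0 <= s <= T)) in Hc.
    - exact Hc.
    - intros s Hs. split; [exact Hs|]. rewrite (Hexp s nu Hs Dnu). apply exp_pos. }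
  match goal with |- D_in _ (fun _ => ?q) _ _ =>
    replace q with (ht t nu * / E); [exact Hln|] end.
  apply (Rmult_eq_reg_r E); [|lra].
  rewrite Rmult_assoc, Rinv_l, Rmult_1_r by lra.
  replace ((P1 nu * E) ^ 2 / E) with (P1 nu * P1 nu * E) in Heq by (field; lra).
  unfold Rdiv in *. lra.
Qed.

(** This is where [|rho| <= 1] matters: for [gamma > 1] the factor vanishes at
    [rho^2 = gamma / (gamma - 1) > 1]. *)
Lemma nonlinear_factor_neq0 gamma rho :
  0 < gamma -> gamma <> 1 -> -1 <= rho <= 1 ->
  rho ^ 2 * (1 - gamma) ^ 2 / gamma + 1 - gamma <> 0.
Proof.
  intros Hg Hg1 Hr H.
  assert (H' : (1 - gamma) * (rho ^ 2 * (1 - gamma) + gamma) = 0).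
  { replace ((1 - gamma) * (rho ^ 2 * (1 - gamma) + gamma)) with
      (gamma * (rho ^ 2 * (1 - gamma) ^ 2 / gamma + 1 - gamma)) by (field; lra).
    rewrite H. ring. }
  destruct (Rmult_integral _ _ H') as [E|E]; [lra|].
  assert (0 <= rho ^ 2 <= 1) by nra.
  destruct (Rlt_or_le gamma 1); nra.
Qed.

(** * Comparison of coefficients *)

(** With [n = m + 3], the derivative [P_t] has degree at most [n], so that its
    coefficient of degree [2n-2 > n] vanishes; on the right-hand side of the PDE
    that coefficient is a nonzero multiple of the square of [a t]. *)
Lemma quadratic_case I t x y m (a : R -> R) (P : R -> R -> R) P1 P2
    beta l0 l1 kap c q0 q1 q2 :
  state_space I -> x < y -> I t -> kap <> 0 ->
  (forall s, I s -> has_top (S (S (S m))) (a s) (P s)) ->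
  has_top (S (S m)) (INR (S (S (S m))) * a t) P1 ->
  has_top (S m) (INR (S (S m)) * (INR (S (S (S m))) * a t)) P2 ->
  (forall nu, x <= nu <= y ->
     D_in (fun s => P s nu)
       (fun _ => beta * P t nu - (l0 + l1 * nu) * P1 nu
          - kap * (P1 nu * P1 nu) - c * P2 nu
          - (q0 + q1 * nu + q2 * nu ^ 2)) I t) ->
  a t = 0.
Proof.
  intros HI Hxy It Hkap HP HP1 HP2 HD.
  set (N := INR (S (S (S m)))) in *.
  assert (HN : 0 < N) by (apply lt_0_INR; lia).
  set (e := (S (S m) + S (S m))%nat).
  assert (HQ : has_top e (- kap * (N * a t * (N * a t)))
    (fun nu => beta * P t nu - (l0 + l1 * nu) * P1 nu
          - kap * (P1 nu * P1 nu) - c * P2 nu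
          - (q0 + q1 * nu + q2 * nu ^ 2))).
  { eapply has_top_ext.
    - apply has_top_plus; [|apply has_top_plus; [|apply has_top_plus;
        [|apply has_top_plus]]].
      + eapply (has_top_scal _ _ beta).
        eapply has_top_raise; [|apply (HP t It)]. unfold e. lia.
      + eapply (has_top_scal _ _ (-1)).
        eapply has_top_raise;
          [|apply (has_top_mult 1 (S (S m))); [apply (has_top_linear l0 l1)|exact HP1]].
        unfold e. lia.
      + eapply (has_top_scal _ _ (- kap)). apply has_top_mult; exact HP1.
      + eapply (has_top_scal _ _ (- c)).
        eapply has_top_raise; [|exact HP2]. unfold e. lia.
      + eapply (has_top_scal _ _ (-1)).
        eapply (has_top_raise 2); [unfold e; lia|apply (has_top_quadratic q0 q1 q2)].
    - ring.
    - intros nu. cbv beta. ring. }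
  assert (Hz : D_in (fun _ => 0) (fun _ => - kap * (N * a t * (N * a t))) I t).
  { refine (D_in_top_coeff I t e (fun _ => 0) _ P _ x y Hxy It _ HQ HD).
    intros s Is. eapply has_top_raise; [|apply (HP s Is)]. unfold e. lia. }
  assert (Hz0 : D_in (fun _ => 0) (fun _ => 0) I t).
  { apply is_derive_D_in. auto_derive; [easy|ring]. }
  assert (H := D_in_unique I _ _ _ t HI It Hz Hz0). cbv beta in H.
  apply Rmult_integral in H. destruct H as [H|H]; [lra|].
  apply Rmult_integral in H.
  destruct H as [H|H]; apply Rmult_integral in H; destruct H; lra.
Qed.

(** Without the nonlinear term, both sides of the PDE have degree at most
    [n = m + 3], so the coefficient of degree [n] evolves on its own. *)
Lemma linear_case I t x y m (a : R -> R) (P : R -> R -> R) P1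
    beta l0 l1 q0 q1 q2 :
  x < y -> I t ->
  (forall s, I s -> has_top (S (S (S m))) (a s) (P s)) ->
  has_top (S (S m)) (INR (S (S (S m))) * a t) P1 ->
  (forall nu, x <= nu <= y ->
     D_in (fun s => P s nu)
       (fun _ => beta * P t nu - (l0 + l1 * nu) * P1 nu
          - (q0 + q1 * nu + q2 * nu ^ 2)) I t) ->
  D_in a (fun s => (beta - INR (S (S (S m))) * l1) * a s) I t.
Proof.
  intros Hxy It HP HP1 HD.
  refine (D_in_top_coeff I t _ a _ P _ x y Hxy It HP _ HD).
  eapply has_top_ext.
  - apply has_top_plus; [|apply has_top_plus].
    + eapply (has_top_scal _ _ beta), (HP t It).
    + eapply (has_top_scal _ _ (-1)).
      apply (has_top_mult 1 (S (S m))); [apply (has_top_linear l0 l1)|exact HP1].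
    + eapply (has_top_scal _ _ (-1)).
      eapply (has_top_raise 2); [lia|apply (has_top_quadratic q0 q1 q2)].
  - ring.
  - intros nu. cbv beta. ring.
Qed.

Theorem theorem4p8 (T r beta eps gamma rho : R) (D : R -> Prop)
    (eta m1 m2 : R -> R)
    (hT : 0 < T) (hr : 0 < r) (hbeta : 0 < beta) (heps : 0 < eps)
    (hgamma : 0 < gamma) (hgamma1 : gamma <> 1) (hrho : -1 <= rho <= 1)
    (hD : state_space D)
    (heta : quadratic_on D (fun nu => eta nu ^ 2))
    (hm1 : linear_on D m1)
    (hetam2 : linear_on D (fun nu => eta nu * m2 nu))
    (hm2 : constant_on D (fun nu => m2 nu ^ 2))
    (n : nat) (hn : (2 < n)%nat) :
  ~ exists h : R -> R -> R,
      analytical_solution T r beta eps gamma rho D eta m1 m2 n h.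
Proof.
  intros (h & (A & HA & tau & Htau & Hord) & Hsol).
  destruct n as [|[|[|m]]]; try lia. clear hn.
  set (N := S (S (S m))) in *.
  pose proof (ansatz_exp _ _ _ _ _ _ _ hgamma1 HA) as Hexp.
  destruct HA as (_ & HA0 & _).
  pose proof hD as [Hconv (x & y & Dx & Dy & Hxy)].
  assert (Hin : forall nu, x <= nu <= y -> D nu)
    by (intros nu Hnu; exact (Hconv x y nu Dx Dy Hnu)).
  destruct heta as (e0 & e1 & e2 & He), hm1 as (b0 & b1 & Hb),
    hetam2 as (g0 & g1 & Hg), hm2 as (c & Hc).
  set (P := fun t => exponent N A (T - t)).
  set (a := fun t => 1 / INR N * A N (T - t)).
  set (K := rho ^ 2 * (1 - gamma) ^ 2 / gamma + 1 - gamma).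
  assert (HN : 0 < INR N) by (apply lt_0_INR; unfold N; lia).
  assert (Htop : forall t, has_top N (a t) (P t))
    by (intros t; apply has_top_exponent).
  set (l0 := b0 + g0 * (rho * (1 - gamma) / gamma)).
  set (l1 := b1 + g1 * (rho * (1 - gamma) / gamma)).
  set (q0 := r - beta + beta * ln beta + e0 / (2 * gamma)).
  assert (Hpde : forall t, 0 <= t <= T -> exists P1 P2,
    has_top (S (S m)) (INR N * a t) P1 /\
    has_top (S m) (INR (S (S m)) * (INR N * a t)) P2 /\
    forall nu, x <= nu <= y ->
    D_in (fun s => P s nu)
      (fun _ => beta * P t nu - (l0 + l1 * nu) * P1 nu
          - c / 2 * K * (P1 nu * P1 nu) - c / 2 * P2 nu
          - (q0 + e1 / (2 * gamma) * nu + e2 / (2 * gamma) * nu ^ 2))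
      (fun s => 0 <= s <= T) t).
  { intros t Ht.
    (* [eta] and [m2] enter the drift only through their product, which is linear *)
    destruct (has_top_derive _ _ _ (Htop t)) as (P1 & HP1 & DP1).
    destruct (has_top_derive _ _ _ HP1) as (P2 & HP2 & DP2).
    exists P1, P2. split; [exact HP1|]. split; [exact HP2|].
    intros nu Hnu.
    pose proof (log_PDE T r beta gamma rho D eta m1 m2 h P t P1 P2 hD hT
      Hsol Hexp Ht DP1 DP2 nu (Hin nu Hnu)) as H.
    match type of H with D_in _ (fun _ => ?u) _ _ =>
      match goal with |- D_in _ (fun _ => ?v) _ _ =>
        replace v with u; [exact H|] end end.
    rewrite (He nu (Hin nu Hnu)), (Hb nu (Hin nu Hnu)), (Hc nu (Hin nu Hnu)).
    replace (eta nu / gamma * rho * m2 nu * (1 - gamma))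
      with ((eta nu * m2 nu) * (rho * (1 - gamma) / gamma)) by (field; lra).
    rewrite (Hg nu (Hin nu Hnu)). unfold l0, l1, q0, K. field. lra. }
  assert (Hzero : forall t, 0 <= t <= T -> a t = 0).
  { destruct (Req_dec c 0) as [Hc0|Hc0].
    - apply (linear_ode_zero T (beta - INR N * l1) a hT).
      + intros t Ht. destruct (Hpde t Ht) as (P1 & P2 & HP1 & _ & HD).
        refine (linear_case _ t x y m a P P1 beta l0 l1 q0 (e1 / (2 * gamma))
          (e2 / (2 * gamma)) Hxy Ht (fun s _ => Htop s) HP1 _).
        intros nu Hnu. specialize (HD nu Hnu).
        match type of HD with D_in _ (fun _ => ?u) _ _ =>
          match goal with |- D_in _ (fun _ => ?v) _ _ =>
            replace v with u; [exact HD|] end end.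
        rewrite Hc0. field. lra.
      + unfold a. rewrite Rminus_diag, HA0 by (unfold N; lia). ring.
    - intros t Ht. destruct (Hpde t Ht) as (P1 & P2 & HP1 & HP2 & HD).
      refine (quadratic_case _ t x y m a P P1 P2 beta l0 l1 (c / 2 * K) (c / 2)
        q0 (e1 / (2 * gamma)) (e2 / (2 * gamma)) (state_space_time T hT) Hxy Ht _
        (fun s _ => Htop s) HP1 HP2 HD).
      pose proof (nonlinear_factor_neq0 gamma rho hgamma hgamma1 hrho).
      apply Rmult_integral_contrapositive_currified; [lra|assumption]. }
  apply Hord. assert (Ht : 0 <= T - tau <= T) by lra.
  specialize (Hzero _ Ht). unfold a in Hzero.
  replace (T - (T - tau)) with tau in Hzero by ring.
  apply Rmult_integral in Hzero. destruct Hzero as [H|H]; [|exact H].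
  unfold Rdiv in H. rewrite Rmult_1_l in H.
  apply Rinv_neq_0_compat in H; [easy|lra].
Qed.
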